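(* Let $G$ be a connected graph. Then $G_{SR}\cong K_{|\partial(G)|}$ if and only if $\partial(G)=\sigma(G)$.
   Context: All graphs are finite, simple and undirected; $d_G$ is the distance in $G$. A vertex $u$ is maximally distant from $v$ if $d_G(v,w)\le d_G(u,v)$ for every neighbor $w$ of $u$. Vertices $u,v$ are mutually maximally distant (MMD) if each is maximally distant from the other. The boundary $\partial(G)$ is the set of vertices maximally distant from some vertex of $G$. $\sigma(G)$ is the set of simplicial vertices of $G$ (vertices whose neighborhood induces a complete graph). The strong resolving graph $G_{SR}$ has vertex set $\partial(G)$, two vertices being adjacent iff they are MMD in $G$. $K_m$ is the complete graph on $m$ vertices. *)

(* Defs.v *)
From mathcomp Require Import all_boot.

Set Implicit Arguments.
Unset Strict Implicit.
Unset Printing Implicit Defensive.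

Record sgraph := SGraph {
  vertex :> finType;
  adj : rel vertex;
  adj_sym : symmetric adj;
  adj_irrefl : irreflexive adj
}.

Definition iso (G H : sgraph) : Prop :=
  exists2 f : G -> H, bijective f & forall x y, adj (f x) (f y) = adj x y.

Definition connected (G : sgraph) : Prop :=
  forall x y : G, connect (@adj G) x y.

Definition complete_rel (m : nat) : rel 'I_m := fun i j => i != j.

Lemma complete_sym m : symmetric (@complete_rel m).
Proof. by move=> i j; rewrite /complete_rel eq_sym. Qed.

Lemma complete_irrefl m : irreflexive (@complete_rel m).
Proof. by move=> i; rewrite /complete_rel eqxx. Qed.

Definition complete_graph (m : nat) : sgraph :=
  SGraph (@complete_sym m) (@complete_irrefl m).

Section Boundary.

Variable G : sgraph.
Implicit Types u v w x y : G.

Definition walk_of_length x y (n : nat) : bool :=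
  [exists p : n.-tuple G, path (@adj G) x p && (last x p == y)].

(* The least length of a walk from x to y. A shortest walk repeats no vertex,
   so it suffices to search the lengths below #|G|; the junk value #|G| is
   returned exactly when x and y lie in different components. *)
Definition dist x y : nat := find (walk_of_length x y) (iota 0 #|G|).

(* u is maximally distant from v; u = v is allowed, and then the condition
   holds only if u is isolated. *)
Definition max_distant u v : bool :=
  [forall w, adj u w ==> (dist v w <= dist u v)].

Definition mmd u v : bool := max_distant u v && max_distant v u.

Definition boundary : {set G} := [set u | [exists v, max_distant u v]].

Definition simplicial : {set G} :=
  [set u | [forall x, forall y,
     [&& adj u x, adj u y & x != y] ==> adj x y]].

(* The condition u != v keeps the graph simple: an isolated vertex is mutually
   maximally distant from itself. *)
Definition sr_rel : rel {u : G | u \in boundary} :=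
  fun u v : {u : G | u \in boundary} =>
    (val u != val v) && mmd (val u) (val v).

Lemma sr_sym : symmetric sr_rel.
Proof. by move=> u v; rewrite /sr_rel /mmd eq_sym (andbC (max_distant _ _)). Qed.

Lemma sr_irrefl : irreflexive sr_rel.
Proof. by move=> u; rewrite /sr_rel eqxx. Qed.

Definition strong_resolving_graph : sgraph := SGraph sr_sym sr_irrefl.

End Boundary.

(* Main.v *)
Require Import Defs.
From mathcomp Require Import all_boot.

(** In a connected graph, simplicial vertices are maximally distant from every
    other vertex, so [boundary G = simplicial G] makes all boundary pairs MMD.
    Conversely, let [u] have two non-adjacent neighbours [x] and [y], and choose
    [z] at maximal distance from [x] among the vertices reached from [x] by a
    geodesic through [u]; [y] is one, at distance 2, so [z] is not [u]. Then [z]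
    is maximally distant from [x], hence a boundary vertex, while [u] is not maximally distant from [z] because
    its neighbour [x] is farther; so [u] is not MMD to the boundary vertex [z]. *)

Lemma dist_le_walk (G : sgraph) (x : G) (p : seq G) :
  path (@adj G) x p -> dist x (last x p) <= size p.
Proof.
move=> xp; case: (ltnP (size p) #|G|) => [szp | szp]; last first.
  (* Walks this long lie outside the searched range, but [find] never exceeds the length [#|G|] of
     the list. *)
  by apply: leq_trans szp; rewrite -[leqRHS](size_iota 0); apply: find_size.
rewrite leqNgt; apply/negP => /(before_find 0).
rewrite nth_iota // add0n => /negbT/negP; apply.
by apply/existsP; exists (in_tuple p); rewrite xp eqxx.
Qed.

Lemma shortest_walk (G : sgraph) (hG : connected G) (x y : G) :
  exists p, [/\ path (@adj G) x p, last x p = y & size p = dist x y].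
Proof.
have hasw : has (walk_of_length x y) (iota 0 #|G|).
  have /connectP[p0 xp0 ->] := hG x y.
  (* Without repeated vertices, [x :: p] has at most [#|G|] entries, so the length of [p] falls in
     the searched range. *)
  case/shortenP: xp0 => p xp Up _; apply/hasP; exists (size p).
    rewrite mem_iota add0n /=.
    by rewrite -[(size p).+1]/(size (x :: p)) -(card_uniqP Up) max_card.
  by apply/existsP; exists (in_tuple p); rewrite xp eqxx.
have := nth_find 0 hasw.
rewrite nth_iota ?add0n; last by move: hasw; rewrite has_find size_iota.
case/existsP=> p /andP[xp /eqP lastp].
by exists p; rewrite size_tuple.
Qed.

Lemma dist_le_sym (G : sgraph) (hG : connected G) (x y : G) :
  dist y x <= dist x y.
Proof.
have [p [xp <- <-]] := shortest_walk G hG x y.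
have /dist_le_walk : path (@adj G) (last x p) (rev (belast x p)).
  by rewrite rev_path (eq_path (e' := @adj G)) // => a b; rewrite adj_sym.
suff -> : last (last x p) (rev (belast x p)) = x.
  by rewrite size_rev size_belast.
by case: p {xp} => //= a p; rewrite rev_cons last_rcons.
Qed.

Lemma dist_sym (G : sgraph) (hG : connected G) (x y : G) : dist x y = dist y x.
Proof. by apply/eqP; rewrite eqn_leq !dist_le_sym. Qed.

Lemma dist_adj_le (G : sgraph) (hG : connected G) (x y z : G) :
  adj x y -> dist x z <= (dist y z).+1.
Proof.
move=> xy; have [p [yp <- <-]] := shortest_walk G hG y z.
by apply: (@dist_le_walk G x (y :: p)); rewrite /= xy.
Qed.

Lemma dist_eq0 (G : sgraph) (hG : connected G) (x y : G) :
  (dist x y == 0) = (x == y).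
Proof.
apply/eqP/eqP => [d0 | <-].
  have [p [_ lastp]] := shortest_walk G hG x y.
  by rewrite d0 -lastp => /size0nil->.
by apply/eqP; rewrite -leqn0; apply: (@dist_le_walk G x [::]).
Qed.

Lemma dist_eq1 (G : sgraph) (hG : connected G) (x y : G) :
  (dist x y == 1) = adj x y.
Proof.
apply/idP/idP => [/eqP d1 | xy].
  have [[|a [|b p]] [+ + +]] := shortest_walk G hG x y; rewrite d1 //=.
  by rewrite andbT => xa <-.
rewrite eqn_leq lt0n dist_eq0 //; apply/andP; split.
  by apply: (@dist_le_walk G x [:: y]); rewrite /= xy.
by apply: contraTneq xy => ->; rewrite adj_irrefl.
Qed.

(** Let [x] follow [u] on a geodesic to [v]. Any other neighbour [w] of [u] is adjacent to [x], so
    putting [w] in place of [u] gives a walk of the same length. *)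
Lemma simplicial_max_distant (G : sgraph) (hG : connected G) (u v : G) :
  u \in simplicial G -> u != v -> max_distant u v.
Proof.
rewrite inE => /forallP su uv; apply/forallP => w; apply/implyP => uw.
have [[|x p] [/= up lastp szp]] := shortest_walk G hG u v.
  by rewrite lastp eqxx in uv.
case/andP: up => ux xp; rewrite (dist_sym G hG) -szp -lastp.
have [-> | wx] := eqVneq w x; first exact/leqW/dist_le_walk.
apply: (@dist_le_walk G w (x :: p)).
by rewrite /= xp andbT; have /forallP/(_ x)/implyP := su w; apply; apply/and3P.
Qed.

Lemma simplicial_sub_boundary (G : sgraph) (hG : connected G) :
  simplicial G \subset boundary G.
Proof.
apply/subsetP => u su; rewrite inE.
have [v uv | alone] := pickP (fun v => u != v).
  by apply/existsP; exists v; apply: simplicial_max_distant.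
(* In a one-vertex graph, [u] is vacuously maximally distant from itself. *)
apply/existsP; exists u; apply/forallP => w; apply/implyP.
by have /negbFE/eqP <- := alone w; rewrite adj_irrefl.
Qed.

Lemma nonsimplicial_boundary_witness (G : sgraph) (hG : connected G) (u : G) :
  u \notin simplicial G ->
  exists z, [/\ z \in boundary G, u != z & ~~ max_distant u z].
Proof.
rewrite inE negb_forall => /existsP[x]; rewrite negb_forall => /existsP[y].
rewrite negb_imply => /andP[/and3P[ux uy xy] nxy].
have xu : adj x u by rewrite adj_sym.
(* As [x] is adjacent to [u], this equation says that some geodesic from [x] to [z] passes through
   [u]. *)
pose beyond := [pred z : G | dist x z == (dist u z).+1].
have beyond_y : beyond y.
  have /eqP duy : dist u y == 1 by rewrite dist_eq1.
  have := dist_adj_le G hG x u y xu; rewrite /= duy leq_eqVlt => /orP[//|].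
  rewrite ltnS leq_eqVlt ltnS leqn0.
  by rewrite dist_eq1 // dist_eq0 // (negPf nxy) (negPf xy).
case: (arg_maxnP (fun z => dist x z) beyond_y) => z /= /eqP dxz zmax.
exists z; split.
- rewrite inE; apply/existsP; exists x; apply/forallP => w; apply/implyP => zw.
  have wz : adj w z by rewrite adj_sym.
  rewrite [leqRHS](dist_sym G hG) leqNgt; apply/negP => far.
  (* A neighbour [w] of [z] farther from [x] would also lie beyond [u], against the choice of [z]:
     [dist u w + 1 <= dist u z + 2 = dist x z + 1 <= dist x w]. *)
  suff /zmax : dist x w == (dist u w).+1.
    by move=> /= /(leq_trans far); rewrite ltnn.
  rewrite eqn_leq dist_adj_le //=; apply: leq_trans far.
  by rewrite ltnS dxz (dist_sym G hG u w) (dist_sym G hG u z) ?dist_adj_le.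
(* If [z] were [u], maximality would force [dist x y <= 1]. *)
- apply: contraTneq (zmax _ beyond_y) => /= <-.
  have /eqP -> : dist x u == 1 by rewrite dist_eq1.
  by rewrite leq_eqVlt ltnS leqn0 dist_eq1 // dist_eq0 // (negPf nxy).
- apply/negP => /forallP/(_ x)/implyP/(_ ux).
  by rewrite (dist_sym G hG) dxz ltnn.
Qed.

Lemma iso_complete_graph (G : sgraph) (m : nat) : #|G| = m ->
  iso G (complete_graph m) <-> (forall x y : G, x != y -> adj x y).
Proof.
move=> <-; split=> [[f /bij_inj f_inj f_adj] x y xy | G_complete].
  by rewrite -f_adj /= /complete_rel (inj_eq f_inj).
exists enum_rank; first exact: enum_rank_bij.
move=> x y; rewrite /= /complete_rel (inj_eq enum_rank_inj).
by have [<- | /G_complete ->] := eqVneq x y; rewrite ?adj_irrefl.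
Qed.

Theorem theorem10 (G : sgraph) (hG : connected G) :
  iso (strong_resolving_graph G) (complete_graph #|boundary G|) <->
  boundary G = simplicial G.
Proof.
(* [card_sig] makes [#|boundary G|] the order of the strong resolving graph, so only its
   completeness is at stake. *)
have isoE := @iso_complete_graph (strong_resolving_graph G) _ (card_sig _).
split=> [/isoE all_mmd | bdE].
  apply/eqP; rewrite eqEsubset simplicial_sub_boundary // andbT.
  apply/subsetP => u bu; apply: contraT.
  case/(nonsimplicial_boundary_witness G hG) => z [bz uz].
  have /and3P[_ -> //] : sr_rel (exist _ u bu) (exist _ z bz).
  by apply: all_mmd; rewrite -val_eqE.
apply/isoE => u v uv; have sv (w : strong_resolving_graph G) : val w \in simplicial G.
  by rewrite -bdE (valP w).
have vuv : val u != val v by rewrite (inj_eq val_inj).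
by apply/and3P; split; rewrite ?simplicial_max_distant // eq_sym.
Qed.
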